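(* Consider a numerical scheme for autonomous equations which is locally exact and whose discretization of every linear system $\dot x=Ax$ is linear (i.e. of the form $x_{n+1}=M(A,h_n)x_n$ with a matrix $M(A,h_n)$). Then the scheme is linearly stable and, in particular, A-stable.
   Context: A scheme $x_{n+1}=\Phi(x_n,h_n)$ for $\dot x=F(x)$ ($x\in\mathbb{R}^d$, time step $h_n>0$) is locally exact at $\bar x$ if its linearization around $\bar x$ is identical with the exact discretization of the differential equation linearized around $\bar x$, namely $x_{n+1}-\bar x=e^{h_nF'(\bar x)}(x_n-\bar x)+h_n\varphi_1(h_nF'(\bar x))F(\bar x)$, where $\varphi_1(z)=(e^z-1)/z$, $\varphi_1(0)=1$. It is locally exact if there is a sequence $\bar x_n$ with $\bar x_n-x_n=O(h_n)$ such that it is locally exact at $\bar x_n$ for every $n$. A scheme is linearly stable if it is stable when applied to linear equations $\dot x=Ax$ ($A$ a constant real matrix): the numerical solution does not tend to infinity (remains bounded) when the exact solution with the same initial condition is bounded for $t\ge t_0$. A scheme is A-stable if the discretizations of all stable linear equations $\dot x=Ax$ are stable as well. *)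

(* Defs.v *)
From HB Require Import structures.
From mathcomp Require Import all_boot all_order all_algebra.
From mathcomp Require Import all_classical all_reals all_analysis.

Set Implicit Arguments.
Unset Strict Implicit.
Unset Printing Implicit Defensive.

Import Order.TTheory GRing.Theory Num.Theory.
Import numFieldNormedType.Exports.

Local Open Scope classical_set_scope.
Local Open Scope ring_scope.

Section LocallyExactSchemes.
Variables (R : realType) (d : nat).

Local Notation vec := 'cV[R]_d.
Local Notation field := (vec -> vec).

Definition expmx (A : 'M[R]_d) : 'M[R]_d :=
  lim (series (fun k => (k`!%:R)^-1 *: A ^+ k) @ \oo).

(* The entire function (e^z - 1) / z, with value 1 at 0, applied to a matrix
   through its power series, so that singular matrices are covered. *)
Definition phi1mx (A : 'M[R]_d) : 'M[R]_d :=
  lim (series (fun k => (k.+1`!%:R)^-1 *: A ^+ k) @ \oo).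

(* The library's 'J acts on row vectors; points here are columns, so that
   linear systems read x' = A x. *)
Definition jacobian_col (F : field) (x : vec) : 'M[R]_d :=
  \matrix_(i, j) ('d F x (delta_mx j 0)) i 0.

Definition linear_field (A : 'M[R]_d) : field := fun x => A *m x.

(* The step map is total; its values matter only on the vector fields in
   [fields] and for positive time steps. Leaving the class of fields open covers
   differentiable, C^k and smooth right-hand sides alike. *)
Record scheme := Scheme {
  fields : set field;
  step : field -> vec -> R -> vec;
  fields_differentiable : forall F, fields F -> forall x, differentiable F x;
  fields_linear : forall A, fields (linear_field A) }.

Definition trajectory (S : scheme) (F : field) (h : nat -> R) (x : nat -> vec) :=
  (forall n, 0 < h n) /\ forall n, x n.+1 = step S F (x n) (h n).

(* First-order Taylor polynomial of [G] at [xb]. *)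
Definition linearization (G : field) (xb x : vec) : vec :=
  G xb + 'd G xb (x - xb).

Definition exact_linearized_step (F : field) (xb : vec) (h : R) (x : vec) : vec :=
  let B := h *: jacobian_col F xb in
  xb + (expmx B *m (x - xb) + h *: (phi1mx B *m F xb)).

Definition locally_exact_at (S : scheme) (F : field) (h : R) (xb : vec) :=
  let G := fun x => step S F x h in
  differentiable G xb /\ linearization G xb = exact_linearized_step F xb h.

Definition locally_exact (S : scheme) :=
  forall F, fields S F -> forall h x, trajectory S F h x ->
  exists xb : nat -> vec,
    (fun n => xb n - x n) =O_\oo h /\
    (forall n, locally_exact_at S F (h n) (xb n)).

Definition linear_on_linear_systems (S : scheme) :=
  exists M : 'M[R]_d -> R -> 'M[R]_d,
  forall A h x, 0 < h -> step S (linear_field A) x h = M A h *m x.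

Definition linear_solution (A : 'M[R]_d) (y : R -> vec) :=
  forall t : R, is_derive t (1 : R) y (A *m y t).

Definition linearly_stable (S : scheme) :=
  forall A h x, trajectory S (linear_field A) h x ->
  forall t0 y, linear_solution A y -> y t0 = x 0%N ->
  [bounded y t | t in [set t | t0 <= t]] -> bounded_fun x.

Definition stable_linear_equation (A : 'M[R]_d) :=
  forall t0 y, linear_solution A y -> [bounded y t | t in [set t | t0 <= t]].

Definition stable_discretization (S : scheme) (A : 'M[R]_d) :=
  forall h x, trajectory S (linear_field A) h x -> bounded_fun x.

Definition A_stable (S : scheme) :=
  forall A, stable_linear_equation A -> stable_discretization S A.

End LocallyExactSchemes.

(* Main.v *)
Require Import Defs.
From mathcomp Require Import all_boot all_order all_algebra.
From mathcomp Require Import all_classical all_reals all_analysis.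
From mathcomp Require Import ring.

(** On a linear system x' = A x the field is its own linearization, with
    Jacobian A, at every base point. So the prescribed step at any xb is
      xb + e^(hA) (x - xb) + h phi1(hA) A xb,
    and since phi1(B) B = e^B - 1 the three terms in xb cancel: what is left is
    e^(hA) x ([exact_linearized_step_linear_field]), whatever xb is. A step map
    that is linear in x also equals its linearization at any point, so a locally
    exact scheme must advance by exactly e^(hA) ([linear_trajectory_exact]).

    The flow of x' = A x over a time h is multiplication by e^(hA)
    ([linear_solution_flow]), hence the numerical solution consists of the values
    of the exact solution at the times t0 + h_0 + ... + h_(n-1)
    ([linear_trajectory_samples]). All these times are at least t0, so the
    numerical solution inherits any bound of the exact one on [t0, +oo[, which is
    linear stability. A-stability follows because every initial value starts an
    exact solution t |-> e^(tA) v ([linear_solution_expmx]).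

    The exponential and phi1 are power series in matrices. Their convergence and
    the derivative of t |-> e^(tA) are obtained entry by entry, from scalar power
    series whose coefficients are dominated by those of the real exponential. *)

Set Implicit Arguments.
Unset Strict Implicit.
Unset Printing Implicit Defensive.

Import Order.TTheory GRing.Theory Num.Theory.
Import numFieldNormedType.Exports.

Local Open Scope classical_set_scope.
Local Open Scope ring_scope.

(** * Limits and derivatives of matrix-valued functions *)

Lemma normr_mx_entry_le (R : realFieldType) m n (M : 'M[R]_(m, n)) i j :
  `|M i j| <= `|M|.
Proof.
rewrite [leRHS]/Num.Def.normr/= mx_normrE.
exact: (le_bigmax _ (fun ij : 'I_m * 'I_n => `|M ij.1 ij.2|) (i, j)).
Qed.

Lemma cvg_mxP (R : realFieldType) m n (T : Type)
    (F : set_system T) {FF : ProperFilter F}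
    (f : T -> 'M[R]_(m, n)) (L : 'M[R]_(m, n)) :
  f @ F --> L <-> forall i j, (fun x => f x i j) @ F --> L i j.
Proof.
split=> [fL i j|fL].
  exact: (cvg_comp _ _ fL (@coord_continuous R m n i j L)).
apply/cvgrPdist_le => /= e e0.
near=> x.
rewrite /Num.Def.normr/= mx_normrE (bigmax_le _ (ltW e0))//= => i _.
rewrite !mxE/=.
move: i; near: x; apply: filter_forall => /= i.
exact: ((cvgrPdist_le _ _).1 (fL i.1 i.2)).
Unshelve. all: by end_near. Qed.

Lemma cvg_mulmxr (R : realFieldType) m n p (T : Type)
    (F : set_system T) {FF : ProperFilter F}
    (f : T -> 'M[R]_(m, n)) (L : 'M[R]_(m, n)) (B : 'M[R]_(n, p)) :
  f @ F --> L -> (fun x => f x *m B) @ F --> L *m B.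
Proof.
move=> /cvg_mxP fL; apply/cvg_mxP => i j.
rewrite mxE; under eq_fun do rewrite mxE.
apply: cvg_big => [|k _]; first exact: add_continuous.
by apply: cvgMr_tmp; exact: fL.
Qed.

Lemma cvg_mulmxl (R : realFieldType) m n p (T : Type)
    (F : set_system T) {FF : ProperFilter F}
    (A : 'M[R]_(m, n)) (f : T -> 'M[R]_(n, p)) (L : 'M[R]_(n, p)) :
  f @ F --> L -> (fun x => A *m f x) @ F --> A *m L.
Proof.
move=> /cvg_mxP fL; apply/cvg_mxP => i j.
rewrite mxE; under eq_fun do rewrite mxE.
apply: cvg_big => [|k _]; first exact: add_continuous.
by apply: cvgMl_tmp; exact: fL.
Qed.

Lemma is_derive_mxP (R : realFieldType) (V : normedModType R) m n
    (M : V -> 'M[R]_(m, n)) (x v : V) (D : 'M[R]_(m, n)) :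
  is_derive x v M D <-> forall i j, is_derive x v (fun z => M z i j) (D i j).
Proof.
split=> [[Mx DE] i j|DM].
  split; first by move/derivable_mxP : Mx => /(_ i j).
  by rewrite -DE derive_mx// mxE.
have Mx : derivable M x v by apply/derivable_mxP => i j; case: (DM i j).
split=> //; rewrite derive_mx//; apply/matrixP => i j; rewrite mxE.
by case: (DM i j).
Qed.

Lemma is_derive_mulmx (R : realFieldType) (V : normedModType R) m n p
    (F : V -> 'M[R]_(m, n)) (G : V -> 'M[R]_(n, p)) (x v : V) dF dG :
  is_derive x v F dF -> is_derive x v G dG ->
  is_derive x v (fun z => F z *m G z) (dF *m G x + F x *m dG).
Proof.
move=> /is_derive_mxP DF /is_derive_mxP DG; apply/is_derive_mxP => i j.
have -> : (fun z => (F z *m G z) i j) =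
    \sum_(k < n) ((fun z => F z i k) * (fun z => G z k j)).
  by apply/funext => z; rewrite mxE fct_sumE.
have -> : (dF *m G x + F x *m dG) i j =
    \sum_(k < n) (F x i k *: dG k j + G x k j *: dF i k).
  rewrite !mxE -big_split/=; apply: eq_bigr => k _.
  by rewrite addrC [X in _ + X]mulrC.
by apply: is_derive_sum => k; exact: is_deriveM.
Qed.

Lemma is_derive_mx_comp (R : realType) m n (M : R -> 'M[R]_(m, n)) (g : R -> R)
    (x b : R) D :
  is_derive (g x) 1 M D -> is_derive x 1 g b ->
  is_derive x 1 (fun z => M (g z)) (b *: D).
Proof.
move=> /is_derive_mxP DM Dg; apply/is_derive_mxP => i j; rewrite mxE mulrC.
exact: (@is_derive1_comp _ (fun z => M z i j) g).
Qed.

(** * The matrix exponential *)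

Section mx_power_series.
Variables (R : realType) (d : nat).
Implicit Types A B : 'M[R]_d.

Lemma expr_scalemx (s : R) A k : (s *: A) ^+ k = s ^+ k *: A ^+ k.
Proof.
elim: k => [|k IH]; first by rewrite !expr0 scale1r.
by rewrite !exprS IH -!mulmxE -scalemxAl -scalemxAr scalerA.
Qed.

(** The max norm of entries is not submultiplicative: an entry of a product is a
    sum of d products, so each factor costs a factor d. *)
Lemma normr_expr_mx_entry_le A k i j : `|(A ^+ k) i j| <= (d%:R * `|A|) ^+ k.
Proof.
elim: k i j => [|k IH] i j.
  by rewrite !expr0 mxE; case: (_ == _); rewrite ?normr1 ?normr0.
rewrite exprSr -mulmxE mxE (le_trans (ler_norm_sum _ _ _))//.
apply: (@le_trans _ _ (\sum_(l < d) (d%:R * `|A|) ^+ k * `|A|)).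
  by apply: ler_sum => l _; rewrite normrM ler_pM// normr_mx_entry_le.
by rewrite sumr_const card_ord exprSr mulrCA -[leLHS]mulr_natl.
Qed.

Lemma is_cvg_series_dominated_exp (u : R^nat) (C r : R) :
  (forall k, `|u k| <= C * exp_coeff r k) -> cvgn (series u).
Proof.
move=> ule; apply: normed_cvg; apply: (series_le_cvg _ _ ule) => //.
  by move=> k; exact: le_trans (ule k).
exact/is_cvg_seriesZ/is_cvg_series_exp_coeff.
Qed.

(** The bound on the coefficients is the one that [expmx] and [phi1mx] share. *)
Lemma mx_pseries_cvg (c : R^nat) A :
  (forall k, `|c k| <= (k`!%:R)^-1) ->
  series (fun k => c k *: A ^+ k) @ \oo -->
    \matrix_(i, j) limn (series (fun k => c k * (A ^+ k) i j)).
Proof.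
move=> cle; apply/cvg_mxP => i j; rewrite mxE.
rewrite (_ : (fun n => _) = series (fun k => c k * (A ^+ k) i j)); last first.
  apply/funext => n; rewrite /series/= summxE.
  by apply: eq_bigr => k _; rewrite mxE.
apply: (@is_cvg_series_dominated_exp _ 1 (d%:R * `|A|)) => k.
rewrite mul1r normrM mulrC /exp_coeff/= ler_pM//.
exact: normr_expr_mx_entry_le.
Qed.

Lemma expmx_cvg A : series (fun k => (k`!%:R)^-1 *: A ^+ k) @ \oo --> expmx A.
Proof.
apply/cvg_ex; eexists; apply: mx_pseries_cvg => k.
by rewrite ger0_norm.
Qed.

Lemma phi1mx_cvg A :
  series (fun k => (k.+1`!%:R)^-1 *: A ^+ k) @ \oo --> phi1mx A.
Proof.
apply/cvg_ex; eexists; apply: mx_pseries_cvg => k.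
rewrite ger0_norm// lef_pV2 ?posrE ?ltr0n ?fact_gt0// ler_nat factS.
by rewrite leq_pmull.
Qed.

Lemma expmxE A i j :
  expmx A i j = limn (series (fun k => (k`!%:R)^-1 * (A ^+ k) i j)).
Proof.
rewrite /expmx (cvg_lim _ (mx_pseries_cvg _)) ?mxE// => k.
by rewrite ger0_norm.
Qed.

Lemma expmx0 : expmx (0 : 'M[R]_d) = 1%:M.
Proof.
apply: cvg_lim => //; rewrite -cvg_shiftS; apply: cvg_near_cst; near=> n.
rewrite /series/= big_nat_recl//= expr0 fact0 invr1 scale1r big1 ?addr0//.
by move=> k _; rewrite expr0n/= scaler0.
Unshelve. all: by end_near. Qed.

Lemma expmx_comm A B : A *m B = B *m A -> A *m expmx B = expmx B *m A.
Proof.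
move=> AB; apply: (norm_cvg_unique (cvg_mulmxl (@expmx_cvg B))).
rewrite (_ : (fun n => _) =
    (fun n => series (fun k => (k`!%:R)^-1 *: B ^+ k) n *m A)).
  exact: cvg_mulmxr (@expmx_cvg B).
apply/funext => n; rewrite /series/= mulmx_sumr mulmx_suml; apply: eq_bigr => k _.
by rewrite -scalemxAl -scalemxAr !mulmxE; congr (_ *: _); exact: commrX.
Qed.

(** The matrix form of phi1(z) z = e^z - 1: multiplying the series of phi1 by A
    gives the series of the exponential without its constant term. *)
Lemma phi1mx_mulmx A : phi1mx A *m A = expmx A - 1%:M.
Proof.
apply: (norm_cvg_unique (cvg_mulmxr (@phi1mx_cvg A))).
rewrite (_ : (fun n => _) =
  (fun n => series (fun k => (k`!%:R)^-1 *: A ^+ k) n.+1 - 1%:M)); last first.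
  apply/funext => n; rewrite /series/= big_nat_recl//= expr0 fact0 invr1 scale1r.
  rewrite [X in X - _]addrC addrK mulmx_suml; apply: eq_bigr => k _.
  by rewrite -scalemxAl mulmxE -exprSr.
apply: cvgB; last exact: cvg_cst.
rewrite (@cvg_shiftS _ (series (fun k => (k`!%:R)^-1 *: A ^+ k))).
exact: expmx_cvg.
Qed.

(** Each entry of e^(tA) is a scalar power series in t, so termwise
    differentiation of scalar power series applies; differentiating the
    coefficients (A^k)_ij / k! turns A^k into A^(k+1). *)
Lemma is_derive_expmx A (t : R) :
  is_derive t 1 (fun s : R => expmx (s *: A)) (A *m expmx (t *: A)).
Proof.
apply/is_derive_mxP => i j.
(* c m is the coefficient sequence after m differentiations. Termwise
   differentiation asks that c 0, c 1 and c 2 give convergent series. *)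
pose c m : R^nat := fun k => (k`!%:R)^-1 * (A ^+ (k + m)) i j.
have dc m : pseries_diffs (c m) = c m.+1.
  apply/funext => k; rewrite /pseries_diffs /c addSn -addnS factS natrM invfM.
  by rewrite !mulrA divff ?mul1r// pnatr_eq0.
have cvgc m x : cvgn (pseries (c m) x).
  apply: (@is_cvg_series_dominated_exp _ ((d%:R * `|A|) ^+ m)
    (d%:R * `|A| * `|x|)) => k.
  rewrite /c /exp_coeff/= !normrM normfV normr_nat normrX.
  have := normr_expr_mx_entry_le A (k + m) i j; rewrite [leRHS]exprD => le_A.
  rewrite [leRHS](_ : _ = (k`!%:R)^-1 *
      ((d%:R * `|A|) ^+ k * (d%:R * `|A|) ^+ m) * `|x| ^+ k).
    by rewrite !ler_pM.
  by rewrite (exprMn _ (d%:R * `|A|)); ring.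
have EA s : expmx (s *: A) i j = limn (pseries (c 0%N) s).
  rewrite expmxE; congr (limn (series _)); apply/funext => k.
  by rewrite expr_scalemx mxE /c /= addn0 mulrAC mulrA.
have AE : (A *m expmx (t *: A)) i j = limn (pseries (c 1%N) t).
  apply/esym/cvg_lim => //.
  pose S n := A *m series (fun k => (k`!%:R)^-1 *: (t *: A) ^+ k) n.
  have SAE : S @ \oo --> A *m expmx (t *: A).
    exact: cvg_mulmxl (@expmx_cvg (t *: A)).
  have : (fun n => S n i j) @ \oo --> (A *m expmx (t *: A)) i j.
    exact: (cvg_mxP _ _).1.
  apply: cvg_trans; apply: near_eq_cvg; near=> n.
  rewrite /S /pseries /series/= mulmx_sumr summxE; apply: eq_bigr => k _.
  rewrite expr_scalemx -!scalemxAr mulmxE -exprS !mxE /c /= addn1.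
  by rewrite mulrAC mulrA.
rewrite (_ : (fun s => _) = fun s => limn (pseries (c 0%N) s)) ?AE -?dc.
  apply: (@pseries_snd_diffs _ _ (`|t| + 1)); rewrite ?dc//.
  by rewrite [ltRHS]ger0_norm ?ltrDl// addr_ge0.
by apply/funext => s; rewrite EA.
Unshelve. all: by end_near. Qed.

End mx_power_series.

(** * Solutions of linear equations *)

Section linear_equations.
Variables (R : realType) (d : nat).
Implicit Types (A : 'M[R]_d) (y : R -> 'cV[R]_d).

(** Uniqueness of solutions: t |-> e^((s+h-t)A) y(t) has zero derivative, because A
    commutes with e^((s+h-t)A); it is e^(hA) y(s) at t = s and y(s+h) at
    t = s+h. *)
Lemma linear_solution_flow A y (s h : R) :
  linear_solution A y -> y (s + h) = expmx (h *: A) *m y s.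
Proof.
move=> yA; pose w (t : R) := expmx ((s + h - t) *: A) *m y t.
have w' (t : R) : is_derive t 1 w 0.
  have DE : is_derive t (1 : R) (fun t : R => expmx ((s + h - t) *: A))
                     (- (A *m expmx ((s + h - t) *: A))).
    have Ds : is_derive t (1 : R) (fun t : R => s + h - t) (- 1).
      by rewrite -[- 1]add0r; exact: is_deriveB.
    by rewrite -scaleN1r; exact: is_derive_mx_comp (is_derive_expmx A _) Ds.
  have := is_derive_mulmx DE (yA t).
  by rewrite expmx_comm ?mulNmx -?mulmxA ?addNr// -scalemxAl -scalemxAr.
have : w (s + h) = w s.
  apply/matrixP => i j.
  by apply: (@is_derive_0_is_cst _ (fun t => w t i j)) => t;
    have /is_derive_mxP/(_ i j) := w' t; rewrite mxE.
by rewrite /w subrr scale0r expmx0 mul1mx addrAC subrr add0r.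
Qed.

Lemma linear_solution_expmx A (v : 'cV[R]_d) :
  linear_solution A (fun t => expmx (t *: A) *m v).
Proof.
move=> t; have := is_derive_mulmx (is_derive_expmx A t) (is_derive_cst v t 1).
by rewrite mulmx0 addr0 mulmxA.
Qed.

(** * Locally exact schemes on linear equations *)

(** The difference quotient of a linear field along v is constantly A v. *)
Lemma derive_linear_field A (x v : 'cV[R]_d) : 'D_v (linear_field A) x = A *m v.
Proof.
apply: cvg_lim => //; apply: (@cvg_trans _ ((fun _ => A *m v) @ (0 : R)^')).
  apply: near_eq_cvg; near=> h; rewrite /linear_field /= mulmxDr addrK -scalemxAr.
  by rewrite scalerA mulVf ?scale1r//; near: h; exact: nbhs_dnbhs_neq.
exact: cvg_cst.
Unshelve. all: by end_near. Qed.

Lemma diff_linear_field A (x v : 'cV[R]_d) :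
  differentiable (linear_field A) x -> 'd (linear_field A) x v = A *m v.
Proof. by move=> Ax; rewrite -deriveE// derive_linear_field. Qed.

Lemma jacobian_col_linear_field A (x : 'cV[R]_d) :
  differentiable (linear_field A) x -> jacobian_col (linear_field A) x = A.
Proof.
move=> Ax; apply/matrixP => i j; rewrite mxE diff_linear_field// mxE.
rewrite (bigD1 j)//= mxE !eqxx mulr1 big1 ?addr0// => k kj.
by rewrite mxE (negbTE kj) mulr0.
Qed.

(** The base point drops out because h phi1(hA) A xb = (e^(hA) - 1) xb. This is why
    local exactness at unspecified points determines the whole step. *)
Lemma exact_linearized_step_linear_field A (xb : 'cV[R]_d) h x :
  differentiable (linear_field A) xb ->
  exact_linearized_step (linear_field A) xb h x = expmx (h *: A) *m x.
Proof.
move=> Axb; rewrite /exact_linearized_step jacobian_col_linear_field//.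
have -> : h *: (phi1mx (h *: A) *m linear_field A xb) =
    (expmx (h *: A) - 1%:M) *m xb.
  by rewrite -phi1mx_mulmx -scalemxAr -scalemxAl mulmxA.
by rewrite mulmxBl mul1mx mulmxBr subrKA addrC subrK.
Qed.

Lemma linearization_linear_field A (xb x : 'cV[R]_d) :
  differentiable (linear_field A) xb ->
  linearization (linear_field A) xb x = A *m x.
Proof.
by move=> Axb; rewrite /linearization diff_linear_field// -mulmxDr addrC subrK.
Qed.

Lemma linear_trajectory_exact (S : scheme R d) A h x :
  locally_exact S -> linear_on_linear_systems S ->
  trajectory S (linear_field A) h x ->
  forall n, x n.+1 = expmx (h n *: A) *m x n.
Proof.
move=> exS [M SM] traj n; have [h0 xS] := traj.
have [xb [_ /(_ n)[dG lin]]] := exS _ (fields_linear S A) _ _ traj.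
have GM : (fun z => step S (linear_field A) z (h n)) = linear_field (M A (h n)).
  by apply/funext => z; exact: SM.
(* Compare the two affine maps at the current point x n. *)
move: dG lin; rewrite GM => dG /(congr1 (@^~ (x n))).
rewrite linearization_linear_field// exact_linearized_step_linear_field; last first.
  exact/(fields_differentiable (fields_linear S A)).
by move=> <-; rewrite xS SM.
Qed.

Lemma linear_trajectory_samples (S : scheme R d) A h x t0 y :
  locally_exact S -> linear_on_linear_systems S ->
  trajectory S (linear_field A) h x ->
  linear_solution A y -> y t0 = x 0%N ->
  forall n, x n = y (t0 + \sum_(k < n) h k).
Proof.
move=> exS linS traj yA y0; elim=> [|n IH]; first by rewrite big_ord0 addr0.
rewrite (linear_trajectory_exact exS linS traj) IH big_ord_recr/= addrA.
by rewrite -linear_solution_flow.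
Qed.

End linear_equations.

Theorem corollary6p2 (R : realType) (d : nat) (S : scheme R d) :
  locally_exact S -> linear_on_linear_systems S ->
  linearly_stable S /\ A_stable S.
Proof.
move=> exS linS; have stabS : linearly_stable S.
  move=> A h x traj t0 y yA y0 [K [Kreal yK]].
  exists K; split=> // N KN n _ /=.
  rewrite (linear_trajectory_samples exS linS traj yA y0).
  apply: (yK N KN) => /=; rewrite lerDl; apply: sumr_ge0 => k _.
  by have [/(_ k)/ltW] := traj.
split=> // A stA h x traj.
have yA := linear_solution_expmx A (x 0%N).
apply: (stabS _ _ _ traj 0 _ yA _ (stA _ _ yA)).
by rewrite scale0r expmx0 mul1mx.
Qed.
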